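(* Let $\mathcal{B}=(\mathcal{O},\mathscr{C},\mathfrak{R},I,T)$ be a bud generating system such that $\mathcal{O}$ is a locally finite operad and $\mathfrak{R}(1)$ finitely factorizes $\mathbf{Bud}_{\mathscr{C}}(\mathcal{O})$. Then the hook generating series of $\mathcal{B}$ satisfies $$\mathrm{hook}(\mathcal{B})=\sum_{\substack{\mathfrak{t}\in\mathbf{Free}(\mathfrak{R})\\ \mathrm{out}(\mathfrak{t})\in I\\ \mathrm{in}(\mathfrak{t})\in T^+}}\frac{\deg(\mathfrak{t})!}{\prod_{v\in\mathcal{N}(\mathfrak{t})}\deg(\mathfrak{t}_v)}\ \mathrm{ev}_{\mathbf{Bud}_{\mathscr{C}}(\mathcal{O})}(\mathfrak{t}).$$
   Context: Colored operads. Let $\mathscr{C}$ be a finite set of colors. A $\mathscr{C}$-colored operad $\mathcal{C}=\bigsqcup_{n\geq1}\mathcal{C}(n)$ is a nonsymmetric colored set-operad: each $x\in\mathcal{C}(n)$ has arity $|x|=n$, an output color $\mathrm{out}(x)\in\mathscr{C}$ and a word of input colors $\mathrm{in}(x)\in\mathscr{C}^n$ with $i$-th letter $\mathrm{in}_i(x)$; $x\circ_i y\in\mathcal{C}(|x|+|y|-1)$ is defined iff $\mathrm{out}(y)=\mathrm{in}_i(x)$; there are units $\mathbf{1}_a\in\mathcal{C}(1)$, $a\in\mathscr{C}$, with output and input color $a$; the usual associativity and unit axioms hold. The complete composition is $x\circ[y_1,\dots,y_n]:=(\cdots((x\circ_n y_n)\circ_{n-1}y_{n-1})\cdots)\circ_1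 y_1$ (defined when $\mathrm{out}(y_i)=\mathrm{in}_i(x)$ for all $i$). A (monochrome) operad is the case of a single color. $\mathcal{C}$ is locally finite if every $\mathcal{C}(n)$ is finite. Bud operads. For an operad $\mathcal{O}$ with unit $\mathbf{1}$, $\mathbf{Bud}_{\mathscr{C}}(\mathcal{O})$ is the $\mathscr{C}$-colored operad of triples $(a,x,u)\in\mathscr{C}\times\mathcal{O}(n)\times\mathscr{C}^n$, $n\geq1$, with output color $a$, input colors $u$, units $\mathbf{1}_a=(a,\mathbf{1},a)$, and $(a,x,u)\circ_i(b,y,v)=(a,x\circ_i y,u')$ when $b=u_i$, where $u'$ is $u$ with its $i$-th letter replaced by $v$. A bud generating system is a tuple $(\mathcal{O},\mathscr{C},\mathfrak{R},I,T)$ with $\mathcal{O}$ an operad, $\mathscr{C}$ a finite set of colors, $\mathfrak{R}$ a finite subset of $\mathbf{Bud}_{\mathscr{C}}(\mathcal{O})$ (rules) and $I,T\subseteq\mathscr{C}$. $T^+$ is the set of nonempty words on $T$. Trees. For a subset $S$ of a $\mathscr{C}$-colored operad $\mathcal{C}$, $S(1)$ is the set of its elements of arity $1$, and $\mathbf{Free}(S)$ is the set of $\mathscr{C}$-colored $S$-syntax trees: planar rooted trees whose internal nodes with $n\geq1$ children are labeled by arity-$n$ elements of $S$, such that if $v$ is the $i$-th child of $u$ (both internal) then the output color of the label of $v$ is the $i$-th input color of the label of $u$; it contains, for each color $a$, a degree-$0$ tree consisting of one leaf with output and input color $a$. For a tree $\mathfrak{t}$: $\mathcal{N}(\mathfrak{t})$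 is its set of internal nodes, $\deg(\mathfrak{t})=\#\mathcal{N}(\mathfrak{t})$, $\mathfrak{t}_v$ is the subtree rooted at $v$, $\mathrm{out}(\mathfrak{t})$ is the output color of the root label, and $\mathrm{in}(\mathfrak{t})$ is the word of input colors of its leaves from left to right. The evaluation $\mathrm{ev}_{\mathcal{C}}(\mathfrak{t})\in\mathcal{C}$ is obtained by composing in $\mathcal{C}$ the labels along $\mathfrak{t}$ (the one-leaf tree of color $a$ evaluates to $\mathbf{1}_a$). $S$ finitely factorizes $\mathcal{C}$ if for each $x\in\mathcal{C}$ there are finitely many $\mathfrak{t}\in\mathbf{Free}(S)$ with $\mathrm{ev}_{\mathcal{C}}(\mathfrak{t})=x$. Series. $\mathbb{K}$ is a field of characteristic zero. A $\mathcal{C}$-series is a map $\mathbf{f}:\mathcal{C}\to\mathbb{K}$, with values denoted $\langle x,\mathbf{f}\rangle$, written $\mathbf{f}=\sum_{x}\langle x,\mathbf{f}\rangle x$. The characteristic series of a subset is its indicator function. $\mathbf{u}$ is the characteristic series of $\{\mathbf{1}_a:a\in\mathscr{C}\}$. Pre-Lie product: $\langle x,\mathbf{f}\curvearrowleft\mathbf{g}\rangle:=\sum_{y,z\in\mathcal{C},\,i\in[|y|],\,x=y\circ_i z}\langle y,\mathbf{f}\rangle\langle z,\mathbf{g}\rangle$. Composition product: $\langle x,\mathbf{f}\odot\mathbf{g}\rangle:=\sum_{y,z_1,\dots,z_{|y|}\in\mathcal{C},\,x=y\circ[z_1,\dots,z_{|y|}]}\langle y,\mathbf{f}\rangle\prod_{i}\langle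 z_i,\mathbf{g}\rangle$. Set $\mathbf{f}^{\curvearrowleft_0}:=\mathbf{u}$, $\mathbf{f}^{\curvearrowleft_\ell}:=\mathbf{f}^{\curvearrowleft_{\ell-1}}\curvearrowleft\mathbf{f}$ for $\ell\geq1$, and $\mathbf{f}^{\curvearrowleft_*}:=\sum_{\ell\geq0}\mathbf{f}^{\curvearrowleft_\ell}$. Let $\mathbf{r}$, $\mathbf{i}$, $\mathbf{t}$ be the characteristic series of $\mathfrak{R}$, $\{\mathbf{1}_a:a\in I\}$, $\{\mathbf{1}_a:a\in T\}$ in $\mathbf{Bud}_{\mathscr{C}}(\mathcal{O})$. The hook generating series is the $\mathbf{Bud}_{\mathscr{C}}(\mathcal{O})$-series $\mathrm{hook}(\mathcal{B}):=\mathbf{i}\odot\mathbf{r}^{\curvearrowleft_*}\odot\mathbf{t}$ (well-defined under the hypotheses of the claim). *)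

(* Defs.v *)
From HB Require Import structures.
From mathcomp Require Import all_boot all_order all_algebra.
From mathcomp Require Import boolp classical_sets functions cardinality fsbigop.

Set Implicit Arguments.
Unset Strict Implicit.
Unset Printing Implicit Defensive.

Import GRing.Theory.

Local Open Scope classical_set_scope.
Local Open Scope ring_scope.

Definition subst_at (A : Type) (u : seq A) (i : nat) (v : seq A) : seq A :=
  (take i u ++ v ++ drop i.+1 u)%SEQ.

(* Nonsymmetric C-colored set-operads. All positions are numbered from 0, so
   that the i-th input of the literature is the input i.-1 here. The partial
   composition x o_i y is total as a Rocq function, but it is meaningful only
   when the input color of x at position i exists and equals the output color
   of y; nothing is assumed about the other values, and every use below is
   guarded by this condition. *)
Record colored_operad (C : finType) := ColoredOperad {
  op_car :> choiceType;
  op_out : op_car -> C;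
  op_in : op_car -> seq C;
  op_unit : C -> op_car;
  op_comp : op_car -> nat -> op_car -> op_car;
  op_arity_gt0 : forall x, (0 < size (op_in x))%N;
  op_out_unit : forall a, op_out (op_unit a) = a;
  op_in_unit : forall a, op_in (op_unit a) = [:: a];
  op_out_comp : forall x i y, onth (op_in x) i = Some (op_out y) ->
    op_out (op_comp x i y) = op_out x;
  op_in_comp : forall x i y, onth (op_in x) i = Some (op_out y) ->
    op_in (op_comp x i y) = subst_at (op_in x) i (op_in y);
  op_unitl : forall x, op_comp (op_unit (op_out x)) 0 x = x;
  op_unitr : forall x i a, onth (op_in x) i = Some a ->
    op_comp x i (op_unit a) = x;
  op_comp_seq : forall x y z i j,
    onth (op_in x) i = Some (op_out y) -> onth (op_in y) j = Some (op_out z) ->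
    op_comp (op_comp x i y) (i + j) z = op_comp x i (op_comp y j z);
  op_comp_par : forall x y z i k, (i < k)%N ->
    onth (op_in x) i = Some (op_out y) -> onth (op_in x) k = Some (op_out z) ->
    op_comp (op_comp x i y) (k + size (op_in y)).-1 z =
    op_comp (op_comp x k z) i y
}.

Definition arity (C : finType) (P : colored_operad C) (x : P) : nat :=
  size (op_in x).

Definition composable (C : finType) (P : colored_operad C)
    (x : P) (i : nat) (y : P) : Prop :=
  onth (op_in x) i = Some (op_out y).

Definition operad := colored_operad unit.

Definition locally_finite (C : finType) (P : colored_operad C) : Prop :=
  forall n : nat, finite_set [set x : P | arity x = n].

(* [full_comp x [:: y_0; ...; y_(n-1)]] grafts y_(n-1) first and y_0 last. *)
Definition full_comp (C : finType) (P : colored_operad C)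
    (x : P) (ys : seq P) : P :=
  foldr (fun p acc => op_comp acc p.1 p.2) x (zip (iota 0 (size ys)) ys).

Definition full_composable (C : finType) (P : colored_operad C)
    (x : P) (ys : seq P) : Prop :=
  [seq op_out y | y <- ys] = op_in x.

Lemma onth_split (A : Type) (u : seq A) i a : onth u i = Some a ->
  exists u1 u2, u = (u1 ++ a :: u2)%SEQ /\ size u1 = i.
Proof.
elim: u i => [|b u IH] [|i] //=; first by case=> ->; exists [::], u.
by move=> /IH [u1 [u2 [-> <-]]]; exists (b :: u1), u2.
Qed.

Lemma subst_at_cat (A : Type) (u1 u2 v : seq A) a :
  subst_at (u1 ++ a :: u2) (size u1) v = (u1 ++ v ++ u2)%SEQ.
Proof. by rewrite /subst_at take_size_cat// -cat_rcons drop_size_cat ?size_rcons. Qed.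

Lemma size_subst_at (A B : Type) (s : seq A) (u : seq B) t v i :
  size s = size u -> size t = size v ->
  size (subst_at s i t) = size (subst_at u i v).
Proof. by move=> e1 e2; rewrite /subst_at !size_cat !size_take !size_drop e1 e2. Qed.

Lemma subst_at_seq (A : Type) (u v w : seq A) i j (a b : A) :
  onth u i = Some a -> onth v j = Some b ->
  subst_at (subst_at u i v) (i + j) w = subst_at u i (subst_at v j w).
Proof.
move=> hu hv; have [u1 [u2 [-> <-]]] := onth_split hu.
have [v1 [v2 [-> <-]]] := onth_split hv.
rewrite !subst_at_cat -!catA /= -size_cat.
by rewrite [in LHS]catA subst_at_cat !catA.
Qed.

Lemma subst_at_par (A : Type) (u v w : seq A) i k (a b : A) : (i < k)%N ->
  onth u i = Some a -> onth u k = Some b ->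
  subst_at (subst_at u i v) (k + size v).-1 w = subst_at (subst_at u k w) i v.
Proof.
move=> ik hu; have [u1 [u2 [-> iE]]] := onth_split hu; rewrite -iE in ik *.
rewrite onth_cat ltnNge (ltnW ik) /= -(subnSK ik) /= => hv.
have [v1 [v2 [-> szv1]]] := onth_split hv.
have kE : k = size (u1 ++ a :: v1)%SEQ.
  by rewrite size_cat /= szv1 subnSK // subnKC // ltnW.
rewrite subst_at_cat.
have -> : (k + size v).-1 = size (u1 ++ v ++ v1)%SEQ.
  by rewrite kE !size_cat /= addnS addSn /= -addnA (addnC (size v)).
have -> : (u1 ++ v ++ v1 ++ b :: v2 = (u1 ++ v ++ v1) ++ b :: v2)%SEQ.
  by rewrite !catA.
rewrite subst_at_cat kE.
have -> : (u1 ++ a :: v1 ++ b :: v2 = (u1 ++ a :: v1) ++ b :: v2)%SEQ.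
  by rewrite -catA.
by rewrite subst_at_cat -!catA /= subst_at_cat.
Qed.

Definition bud_car (C : finType) (O : operad) : choiceType :=
  {p : C * O * seq C | size p.2 == arity p.1.2}.

Section BudOperad.
Context (C : finType) (O : operad).
Implicit Types X Y Z : bud_car C O.

Definition bud_out X : C := (\val X).1.1.
Definition bud_elt X : O := (\val X).1.2.
Definition bud_in X : seq C := (\val X).2.

Lemma size_bud_in X : size (bud_in X) = arity (bud_elt X).
Proof. exact/eqP/(valP X). Qed.

Lemma bud_unit_proof (a : C) :
  size (a, op_unit O tt, [:: a]).2 == arity (a, op_unit O tt, [:: a]).1.2.
Proof. by rewrite /arity /= op_in_unit. Qed.

Definition bud_unit (a : C) : bud_car C O :=
  exist _ (a, op_unit O tt, [:: a]) (bud_unit_proof a).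

(* When the composition is defined the triple below has a word of the right
   length ([bud_compE]), so the default value X of [insubd] is not used. *)
Definition bud_comp X (i : nat) Y : bud_car C O :=
  insubd X (bud_out X, op_comp (bud_elt X) i (bud_elt Y),
            subst_at (bud_in X) i (bud_in Y)).

Lemma bud_elt_composable X i Y : onth (bud_in X) i = Some (bud_out Y) ->
  onth (op_in (bud_elt X)) i = Some (op_out (bud_elt Y)).
Proof.
move=> h; have : onth (op_in (bud_elt X)) i.
  by rewrite onthTE -[size _]size_bud_in -onthTE h.
by case: onth => // -[] _; case: (op_out _).
Qed.

Lemma bud_compE X i Y : onth (bud_in X) i = Some (bud_out Y) ->
  \val (bud_comp X i Y) = (bud_out X, op_comp (bud_elt X) i (bud_elt Y),
                           subst_at (bud_in X) i (bud_in Y)).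
Proof.
move=> h; apply: insubdK; rewrite /in_mem /= /arity op_in_comp.
  by apply/eqP/size_subst_at; apply: size_bud_in.
exact: bud_elt_composable.
Qed.

Lemma bud_ext X Y : bud_out X = bud_out Y -> bud_elt X = bud_elt Y ->
  bud_in X = bud_in Y -> X = Y.
Proof.
move=> h1 h2 h3; apply: val_inj; move: h1 h2 h3.
rewrite /bud_out /bud_elt /bud_in.
by case: (\val X) (\val Y) => [[a x] u] [[b y] v] /= -> -> ->.
Qed.

Lemma bud_out_comp X i Y : onth (bud_in X) i = Some (bud_out Y) ->
  bud_out (bud_comp X i Y) = bud_out X.
Proof. by move=> h; rewrite /bud_out bud_compE. Qed.

Lemma bud_elt_comp X i Y : onth (bud_in X) i = Some (bud_out Y) ->
  bud_elt (bud_comp X i Y) = op_comp (bud_elt X) i (bud_elt Y).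
Proof. by move=> h; rewrite /bud_elt bud_compE. Qed.

Lemma bud_in_comp X i Y : onth (bud_in X) i = Some (bud_out Y) ->
  bud_in (bud_comp X i Y) = subst_at (bud_in X) i (bud_in Y).
Proof. by move=> h; rewrite {1}/bud_in bud_compE. Qed.

Lemma bud_in_gt0 X : (0 < size (bud_in X))%N.
Proof. by rewrite size_bud_in; exact: op_arity_gt0. Qed.

Lemma bud_unitl X : bud_comp (bud_unit (bud_out X)) 0 X = X.
Proof.
have h : onth (bud_in (bud_unit (bud_out X))) 0 = Some (bud_out X) by [].
apply: bud_ext; first by rewrite bud_out_comp.
  rewrite bud_elt_comp // /bud_elt /= -/(bud_elt X).
  by have := op_unitl (bud_elt X); case: (op_out _).
by rewrite bud_in_comp // /subst_at /= cats0.
Qed.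

Lemma bud_unitr X i a : onth (bud_in X) i = Some a ->
  bud_comp X i (bud_unit a) = X.
Proof.
move=> h.
have h' : onth (bud_in X) i = Some (bud_out (bud_unit a)) by [].
apply: bud_ext; first by rewrite bud_out_comp.
  rewrite bud_elt_comp //; apply: op_unitr.
  by rewrite (bud_elt_composable h') op_out_unit.
rewrite bud_in_comp // {2}/bud_in /=.
by have [u1 [u2 [-> <-]]] := onth_split h; rewrite subst_at_cat.
Qed.

Lemma onth_subst_at_seq (A : Type) (u v : seq A) i j (a b : A) :
  onth u i = Some a -> onth v j = Some b ->
  onth (subst_at u i v) (i + j) = Some b.
Proof.
move=> hu hv; have [u1 [u2 [-> <-]]] := onth_split hu.
have [v1 [v2 [-> <-]]] := onth_split hv.
rewrite subst_at_cat onth_cat ltnNge leq_addr /= addKn -catA.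
by rewrite onth_cat ltnn subnn.
Qed.

Lemma onth_subst_at_gt (A : Type) (u v : seq A) i k (a b : A) : (i < k)%N ->
  onth u i = Some a -> onth u k = Some b ->
  onth (subst_at u i v) (k + size v).-1 = Some b.
Proof.
move=> ik hu; have [u1 [u2 [-> iE]]] := onth_split hu; rewrite -iE in ik *.
rewrite onth_cat ltnNge (ltnW ik) /= -(subnSK ik) /= => h.
have kE : k = (size u1 + (k - (size u1).+1)).+1.
  by rewrite -addSn subnKC.
rewrite subst_at_cat kE addSn /= onth_cat ltnNge -addnA leq_addr /= addKn.
by rewrite onth_cat ltnNge leq_addl /= addnK.
Qed.

Lemma onth_subst_at_lt (A : Type) (u v : seq A) i k (a b : A) : (i < k)%N ->
  onth u i = Some a -> onth u k = Some b ->
  onth (subst_at u k v) i = Some a.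
Proof.
move=> ik h hu; have [u1 [u2 [uE kE]]] := onth_split hu; move: h; rewrite uE -kE in ik *.
by rewrite subst_at_cat !onth_cat ik.
Qed.

Lemma bud_comp_seq X Y Z i j :
  onth (bud_in X) i = Some (bud_out Y) ->
  onth (bud_in Y) j = Some (bud_out Z) ->
  bud_comp (bud_comp X i Y) (i + j) Z = bud_comp X i (bud_comp Y j Z).
Proof.
move=> h1 h2.
have h3 : onth (bud_in (bud_comp X i Y)) (i + j) = Some (bud_out Z).
  by rewrite bud_in_comp //; apply: onth_subst_at_seq h1 h2.
have h4 : onth (bud_in X) i = Some (bud_out (bud_comp Y j Z)).
  by rewrite bud_out_comp.
apply: bud_ext; first by rewrite !bud_out_comp.
  by rewrite !bud_elt_comp //; apply: op_comp_seq; apply: bud_elt_composable.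
by rewrite (bud_in_comp h3) (bud_in_comp h4) (bud_in_comp h1) (bud_in_comp h2)
  (subst_at_seq _ h1 h2).
Qed.

Lemma bud_comp_par X Y Z i k : (i < k)%N ->
  onth (bud_in X) i = Some (bud_out Y) ->
  onth (bud_in X) k = Some (bud_out Z) ->
  bud_comp (bud_comp X i Y) (k + size (bud_in Y)).-1 Z =
  bud_comp (bud_comp X k Z) i Y.
Proof.
move=> ik h1 h2.
have h3 : onth (bud_in (bud_comp X i Y)) (k + size (bud_in Y)).-1
          = Some (bud_out Z).
  by rewrite bud_in_comp //; apply: onth_subst_at_gt ik h1 h2.
have h4 : onth (bud_in (bud_comp X k Z)) i = Some (bud_out Y).
  by rewrite bud_in_comp //; apply: onth_subst_at_lt ik h1 h2.
apply: bud_ext; first by rewrite !bud_out_comp.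
  rewrite !bud_elt_comp // size_bud_in.
  by apply: op_comp_par => //; apply: bud_elt_composable.
by rewrite (bud_in_comp h3) (bud_in_comp h4) (bud_in_comp h1) (bud_in_comp h2)
  (subst_at_par _ _ ik h1 h2).
Qed.

End BudOperad.

Definition Bud (C : finType) (O : operad) : colored_operad C :=
  @ColoredOperad C (bud_car C O) (@bud_out C O) (@bud_in C O)
    (@bud_unit C O) (@bud_comp C O)
    (@bud_in_gt0 C O) (fun=> erefl) (fun=> erefl)
    (@bud_out_comp C O) (@bud_in_comp C O)
    (@bud_unitl C O) (@bud_unitr C O)
    (@bud_comp_seq C O) (@bud_comp_par C O).

Record bud_generating_system := BudGeneratingSystem {
  bgs_operad : operad;
  bgs_colors : finType;
  bgs_rules : set (Bud bgs_colors bgs_operad);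
  bgs_rules_finite : finite_set bgs_rules;
  bgs_initial : {set bgs_colors};
  bgs_terminal : {set bgs_colors}
}.

Arguments bgs_rules : clear implicits.

Definition bgs_bud (B : bud_generating_system) : colored_operad (bgs_colors B) :=
  Bud (bgs_colors B) (bgs_operad B).

Definition arity_part (C : finType) (P : colored_operad C)
    (S : set P) (n : nat) : set P :=
  [set x | S x /\ arity x = n].

(* Raw trees; a leaf carries its color, and the constraints on arities, colors
   and labels are imposed by [Free] below. *)
Inductive tree (C : finType) (P : colored_operad C) : Type :=
| Leaf of C
| Node of P & seq (tree P).

Arguments Leaf {C P} a.
Arguments Node {C P} x ts.

HB.instance Definition _ (C : finType) (P : colored_operad C) :=
  gen_eqMixin (tree P).
HB.instance Definition _ (C : finType) (P : colored_operad C) :=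
  gen_choiceMixin (tree P).

Section Trees.
Context (C : finType) (P : colored_operad C).

Definition tree_out (t : tree P) : C :=
  match t with Leaf a => a | Node x _ => op_out x end.

Fixpoint tree_in (t : tree P) : seq C :=
  match t with
  | Leaf a => [:: a]
  | Node _ ts => flatten [seq tree_in s | s <- ts]
  end.

Fixpoint is_syntax_tree (S : set P) (t : tree P) : bool :=
  match t with
  | Leaf _ => true
  | Node x ts => [&& x \in S, [seq tree_out s | s <- ts] == op_in x
                   & all (is_syntax_tree S) ts]
  end.

Definition Free (S : set P) : set (tree P) := [set t | is_syntax_tree S t].

(* The list of the subtrees t_v, for v ranging over the internal nodes of t. *)
Fixpoint node_subtrees (t : tree P) : seq (tree P) :=
  match t with
  | Leaf _ => [::]
  | Node _ ts => t :: flatten [seq node_subtrees s | s <- ts]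
  end.

Definition deg (t : tree P) : nat := size (node_subtrees t).

Fixpoint ev (t : tree P) : P :=
  match t with
  | Leaf a => op_unit P a
  | Node x ts => full_comp x [seq ev s | s <- ts]
  end.

Definition finitely_factorizes (S : set P) : Prop :=
  forall x : P, finite_set [set t | Free S t /\ ev t = x].

End Trees.

Definition plus_words (C : finType) (T : {set C}) : set (seq C) :=
  [set u | u <> [::] /\ {subset u <= T}].

(* The sums over sets below are sums of finitely many nonzero terms (with the
   value 0 by convention if the support is infinite). For a locally finite P,
   [prelie] and [composition_prod] always are such finite sums, since arities
   are positive and add up along compositions. *)
Section Series.
Context (K : fieldType) (C : finType) (P : colored_operad C).

Definition series := P -> K.

Definition char_series (S : set P) : series := fun x => (x \in S)%:R.

Definition units_of (A : {set C}) : set P :=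
  [set x | exists2 a, a \in A & x = op_unit P a].

Definition unit_series : series := char_series (units_of [set: C]%SET).

Definition prelie (f g : series) : series := fun x =>
  \sum_(p \in [set p : P * nat * P |
      composable p.1.1 p.1.2 p.2 /\ x = op_comp p.1.1 p.1.2 p.2])
    (f p.1.1 * g p.2).

Definition composition_prod (f g : series) : series := fun x =>
  \sum_(p \in [set p : P * seq P |
      full_composable p.1 p.2 /\ x = full_comp p.1 p.2])
    (f p.1 * \prod_(z <- p.2) g z).

Definition prelie_pow (f : series) (l : nat) : series :=
  iter l (fun h => prelie h f) unit_series.

Definition prelie_star (f : series) : series := fun x =>
  \sum_(l \in [set: nat]) prelie_pow f l x.

(* [series_sum A c e] is the series \sum_(t \in A) c t . e t. *)
Definition series_sum (I : choiceType) (A : set I) (c : I -> K) (e : I -> P) :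
    series := fun x =>
  \sum_(t \in A) (c t * char_series [set e t] x).

End Series.

Arguments units_of {C} P A.

Definition hook (K : fieldType) (B : bud_generating_system) :
    series K (bgs_bud B) :=
  composition_prod
    (composition_prod
      (char_series K (units_of (bgs_bud B) (bgs_initial B)))
      (prelie_star (char_series K (bgs_rules B : set (bgs_bud B)))))
    (char_series K (units_of (bgs_bud B) (bgs_terminal B))).

Arguments hook K B : clear implicits.

(* Main.v *)
Require Import Defs.
From mathcomp Require Import all_boot all_order all_algebra.
From mathcomp Require Import boolp classical_sets functions cardinality fsbigop.
From mathcomp Require Import zify.

Set Implicit Arguments.
Unset Strict Implicit.
Unset Printing Implicit Defensive.

Import GRing.Theory.

Local Open Scope classical_set_scope.
Local Open Scope ring_scope.

(** The [l]-th pre-Lie power of the series of rules counts the ways of writing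
an element as [1_a o_(i_1) z_1 o_(i_2) ... o_(i_l) z_l] with all the [z_k] rules.
Such a word of compositions builds a syntax tree one node at a time, each new
node being grafted on a leaf, so the number of words that produce a given tree
[t] is the number of linear extensions of the forest order on its nodes; the
hook length formula says that this is [(deg t)! / \prod_v deg (t_v)].

The hook length formula is obtained by induction, in the form of an identity for
the weight [w t = 1 / \prod_v deg (t_v)]: summing over all the ways of deleting a
node of [t] whose children are all leaves,
  [\sum_(s obtained from t) w s = deg t * w t]          ([sum_prunings]).
If the root of [t] is not the only node, the root factor of every [s] is
[1 / (deg t - 1)], and the Leibniz rule reduces the identity to the subtrees of
the root, whose degrees add up to [deg t - 1]. Since evaluation turns
grafting into partial composition ([ev_graft]), this identity is the induction
step for
  [<x, r^l> = \sum_(t : deg t = l, ev t = x) l! * w t]  ([prelie_pow_hook]).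

Summing over [l] needs finitely many trees with a given evaluation
([finitely_factorizes_unary]). Arity-one elements are finitely many, and
each has finitely many factorizations into arity-one rules; hence there are
finitely many trees with unary nodes only, and their degrees are bounded by some
[M]. In any tree the chains of unary nodes then have length at most [M], and a tree
with [n] leaves and such short chains has degree at most [M + 2 (n - 1) (M + 1)];
since there are finitely many rules, finitely many trees have a bounded degree.

Finally, composing with the initial (terminal) units on the left (right)
multiplies the coefficient of [x] by the indicator of the condition on its output
(input) colors, which are those of any tree evaluating to [x]. *)

(** * Syntax trees, grafting and pruning *)

Lemma onth_size_lt (A : Type) (u : seq A) i a : onth u i = Some a ->
  (i < size u)%N.
Proof. by move=> h; rewrite -onthTE h. Qed.

Lemma onth_nil (A : Type) i : onth ([::] : seq A) i = None.
Proof. by case: i. Qed.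

Section TreeGrafting.
Context (C : finType) (P : colored_operad C).
Implicit Types (S : set P) (t s : tree P) (ts ss : seq (tree P)) (x y z : P).

(** Simultaneous induction on trees and on forests (lists of trees). *)
Lemma tree_forest_ind (Q : tree P -> Prop) (F : seq (tree P) -> Prop) :
  (forall a, Q (Leaf a)) -> (forall x ts, F ts -> Q (Node x ts)) ->
  F [::] -> (forall t ts, Q t -> F ts -> F (t :: ts)) ->
  (forall t, Q t) /\ (forall ts, F ts).
Proof.
move=> QL QN F0 FS.
have HQ : forall t, Q t.
  fix IH 1 => -[a|x ts]; first exact: QL.
  by apply: QN; elim: ts => [|t ts IHts]; [exact: F0 | apply: FS].
by split=> //; elim=> [|t ts IHts]; [exact: F0 | apply: FS].
Qed.

(** The word of leaf colors of a forest, from left to right. *)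
Definition forest_in ts : seq C := flatten [seq tree_in t | t <- ts].

(** The number of internal nodes of a forest. *)
Definition forest_deg ts : nat := sumn [seq deg t | t <- ts].

Lemma deg_Node x ts : deg (Node x ts) = (forest_deg ts).+1.
Proof. by rewrite /deg /= size_flatten /shape -map_comp. Qed.

Definition is_leaf t : bool := if t is Leaf _ then true else false.

(** The tree with a single internal node, labeled by [z]. *)
Definition corolla z : tree P := Node z [seq Leaf a | a <- op_in z].

(** [forest_graft g ts i] applies the operation [g] on trees at the [i]-th leaf of
the forest [ts], leaves being numbered from [0] across the whole forest: [g t j]
is to act at the [j]-th leaf of [t]. *)
Definition forest_graft (g : tree P -> nat -> tree P) :=
  fix loop ts i := match ts with
  | [::] => [::]
  | t :: ts' => if (i < size (tree_in t))%N then g t i :: ts'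
                else t :: loop ts' (i - size (tree_in t))%N
  end.

(** [graft z t i] replaces the [i]-th leaf of [t] by the corolla of [z]. On a
one-leaf tree the position is not inspected; it is [0] whenever that leaf exists. *)
Fixpoint graft z t i : tree P :=
  match t with
  | Leaf _ => corolla z
  | Node x ts => Node x (forest_graft (graft z) ts i)
  end.

(** The prunings of the forest [ts] when [pr] lists those of its trees; see
[prunings]. *)
Definition forest_prunings (pr : tree P -> seq (tree P * nat * P)) :=
  fix loop ts : seq (seq (tree P) * nat * P) := match ts with
  | [::] => [::]
  | t :: ts' => [seq (p.1.1 :: ts', p.1.2, p.2) | p <- pr t] ++
      [seq (t :: p.1.1, (size (tree_in t) + p.1.2)%N, p.2) | p <- loop ts']
  end.

(** For a syntax tree [t], the list of all the [(s, i, z)] such that [z] can be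
grafted on the [i]-th leaf of [s] and doing so yields [t]: one for each node of
[t] whose children are all leaves. *)
Fixpoint prunings t : seq (tree P * nat * P) :=
  match t with
  | Leaf _ => [::]
  | Node x ts =>
    if all is_leaf ts then [:: (Leaf (op_out x), 0%N, x)]
    else [seq (Node x p.1.1, p.1.2, p.2) | p <- forest_prunings prunings ts]
  end.

Lemma forest_deg_eq0 ts : (forest_deg ts == 0)%N = all is_leaf ts.
Proof.
rewrite /forest_deg; elim: ts => //= t ts <-; rewrite addn_eq0; congr (_ && _).
by case: t => // x us; rewrite deg_Node.
Qed.

Lemma all_leafE ts : all is_leaf ts ->
  ts = [seq Leaf a | a <- [seq tree_out t | t <- ts]].
Proof. by elim: ts => //= -[a|//] ts IH /= /IH {1}->. Qed.

Lemma all_leaf_map (u : seq C) : all is_leaf [seq @Leaf C P a | a <- u].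
Proof. by elim: u. Qed.

(** Every listed pruning of a syntax tree can be grafted back. *)
Lemma prunings_sound S :
  (forall t, is_syntax_tree S t -> forall p, p \in prunings t ->
    [/\ is_syntax_tree S p.1.1, p.2 \in S,
        onth (tree_in p.1.1) p.1.2 = Some (op_out p.2),
        graft p.2 p.1.1 p.1.2 = t & tree_out p.1.1 = tree_out t /\
        deg t = (deg p.1.1).+1]) /\
  (forall ts, all (is_syntax_tree S) ts ->
    forall p, p \in forest_prunings prunings ts ->
    [/\ all (is_syntax_tree S) p.1.1, p.2 \in S,
        onth (forest_in p.1.1) p.1.2 = Some (op_out p.2),
        forest_graft (graft p.2) p.1.1 p.1.2 = ts &
        [seq tree_out t | t <- p.1.1] = [seq tree_out t | t <- ts] /\
        forest_deg ts = (forest_deg p.1.1).+1]).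
Proof.
apply: tree_forest_ind => [//|x ts IH||t ts IHt IHts].
- move=> /= /and3P[xS /eqP xE tsS] p; case: ifP => leaf_ts.
    rewrite mem_seq1 => /eqP -> /=; split=> //.
      by rewrite /corolla -xE -all_leafE.
    split=> //; rewrite deg_Node; congr _.+1.
    by apply/eqP; rewrite forest_deg_eq0.
  move=> /mapP[q /(IH tsS)[qS q2 qin qg [qo qd]] ->] /=; split=> //.
  + by rewrite xS qo xE eqxx.
  + by rewrite qg.
  + by rewrite !deg_Node qd.
- by [].
move=> /= /andP[tS tsS] p; rewrite mem_cat => /orP[] /mapP[q].
  move=> /(IHt tS)[qS q2 qin qg [qo qd]] -> /=; split=> //.
  + by rewrite qS.
  + by rewrite /forest_in /= onth_cat (onth_size_lt qin).
  + by rewrite (onth_size_lt qin) qg.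
  + by rewrite qo; split=> //; rewrite /forest_deg /= qd.
move=> /(IHts tsS)[qS q2 qin qg [qo qd]] -> /=; split=> //.
+ by rewrite tS.
+ by rewrite /forest_in /= onth_cat ltnNge leq_addr /= addKn.
+ by rewrite ltnNge leq_addr /= addKn qg.
+ by rewrite qo; split=> //; move: qd; rewrite /forest_deg /= => ->; rewrite addnS.
Qed.

(** Every grafting is listed, the grafted node being a prunable node of the
result. *)
Lemma prunings_complete z :
  (forall s i, onth (tree_in s) i = Some (op_out z) ->
    ~~ is_leaf (graft z s i) /\ (s, i, z) \in prunings (graft z s i)) /\
  (forall ss i, onth (forest_in ss) i = Some (op_out z) ->
    ~~ all is_leaf (forest_graft (graft z) ss i) /\
    (ss, i, z) \in forest_prunings prunings (forest_graft (graft z) ss i)).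
Proof.
apply: tree_forest_ind => [a|x ts IH||t ts IHt IHts] i /=.
- case: i => [|i] /=; last by rewrite onth_nil.
  move=> [->]; split=> //.
  by rewrite all_leaf_map mem_head.
- move=> /IH[/negbTE h1 h2]; split=> //; rewrite h1.
  by apply/mapP; exists (ts, i, z).
- by rewrite /forest_in /= onth_nil.
rewrite /forest_in /= onth_cat; case: ltnP => it.
  move=> /IHt[/negbTE h1 h2] /=; rewrite h1; split=> //.
  by rewrite mem_cat; apply/orP; left; apply/mapP; exists (t, i, z).
move=> /IHts[/negbTE h1 h2] /=; rewrite h1 andbF; split=> //.
rewrite mem_cat; apply/orP; right; apply/mapP.
by exists (ts, i - size (tree_in t), z)%N; rewrite //= subnKC.
Qed.

Lemma prunings_uniq S :
  (forall t, is_syntax_tree S t -> uniq (prunings t)) /\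
  (forall ts, all (is_syntax_tree S) ts -> uniq (forest_prunings prunings ts)).
Proof.
apply: tree_forest_ind => [//|x ts IH||//t ts IHt IHts].
- move=> /= /and3P[xS /eqP xE tsS]; case: ifP => // _.
  by rewrite map_inj_uniq ?IH// => -[[? ?] ?] [[? ?] ?] /= [-> -> ->].
- by [].
move=> /= /andP[tS tsS]; rewrite cat_uniq; apply/and3P; split.
- by rewrite map_inj_uniq ?IHt// => -[[? ?] ?] [[? ?] ?] /= [-> -> ->].
- (* Pruning [t] lowers its degree, so it differs from leaving [t] unchanged. *)
  apply/hasPn => _ /mapP[q _ ->]; apply/negP => /mapP[p pt [tE _ _ _]].
  have [_ _ _ _ [_]] := (prunings_sound S).1 t tS p pt.
  by rewrite tE => /eqP; rewrite -[X in X == _]addn0 -addn1 eqn_add2l.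
- rewrite map_inj_uniq ?IHts// => -[[? ?] ?] [[? ?] ?] /= [-> h ->].
  by rewrite (addnI h).
Qed.

Lemma tree_out_graft z s i : onth (tree_in s) i = Some (op_out z) ->
  tree_out (graft z s i) = tree_out s.
Proof. by case: s => [a|//]; case: i => [|i] /=; rewrite ?onth_nil // => -[->]. Qed.

Lemma graft_Free S z : z \in S ->
  (forall s i, onth (tree_in s) i = Some (op_out z) ->
    is_syntax_tree S s -> is_syntax_tree S (graft z s i)) /\
  (forall ss i, onth (forest_in ss) i = Some (op_out z) ->
    all (is_syntax_tree S) ss ->
    all (is_syntax_tree S) (forest_graft (graft z) ss i) /\
    [seq tree_out t | t <- forest_graft (graft z) ss i] =
    [seq tree_out t | t <- ss]).
Proof.
move=> zS; apply: tree_forest_ind => [a|x ts IH||t ts IHt IHts] i.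
- move=> _ _ /=; rewrite zS -map_comp map_id eqxx /=.
  by elim: (op_in z).
- by move=> /= iE /and3P[-> /eqP xE] /(IH _ iE)[-> ->]; rewrite xE eqxx.
- by rewrite /forest_in /= onth_nil.
rewrite /forest_in /= onth_cat; case: ltnP => it /= iE /andP[tS tsS].
  by rewrite IHt// tsS tree_out_graft.
by rewrite tS; have [-> ->] := IHts _ iE tsS.
Qed.

Lemma deg_graft z :
  (forall s i, onth (tree_in s) i = Some (op_out z) ->
    deg (graft z s i) = (deg s).+1) /\
  (forall ss i, onth (forest_in ss) i = Some (op_out z) ->
    forest_deg (forest_graft (graft z) ss i) = (forest_deg ss).+1).
Proof.
apply: tree_forest_ind => [a|x ts IH||t ts IHt IHts] i.
- move=> _; rewrite /= deg_Node; congr _.+1.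
  by apply/eqP; rewrite forest_deg_eq0 all_leaf_map.
- by move=> iE; rewrite /= !deg_Node IH.
- by rewrite /forest_in /= onth_nil.
rewrite /forest_in /= onth_cat; case: ltnP => it /= iE.
  by rewrite /forest_deg /= IHt.
by rewrite /forest_deg /= [sumn _]IHts// addnS.
Qed.

Section Weight.
Context (K : fieldType).

(** The inverse of the product of the hook lengths, the hook length of a node being
the degree of the subtree rooted at it. *)
Definition hook_weight t : K := (\prod_(s <- node_subtrees t) (deg s)%:R)^-1.

Lemma hook_weight_Leaf a : hook_weight (Leaf a) = 1.
Proof. by rewrite /hook_weight /= big_nil invr1. Qed.

Lemma hook_weight_Node x ts :
  hook_weight (Node x ts) =
  (forest_deg ts).+1%:R^-1 * \prod_(t <- ts) hook_weight t.
Proof.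
rewrite /hook_weight /= big_cons deg_Node invfM; congr (_ * _).
by rewrite big_flatten /= big_map prodfV.
Qed.

Hypothesis charK0 : [pchar K] =i pred0.

Lemma natrS_neq0 n : n.+1%:R != 0 :> K.
Proof. by rewrite ((pcharf0P K).1 charK0). Qed.

(** The recursion behind the hook length formula. *)
Lemma sum_prunings S :
  (forall t, is_syntax_tree S t ->
    \sum_(p <- prunings t) hook_weight p.1.1 = (deg t)%:R * hook_weight t) /\
  (forall ts, all (is_syntax_tree S) ts ->
    \sum_(p <- forest_prunings prunings ts) \prod_(s <- p.1.1) hook_weight s =
    (forest_deg ts)%:R * \prod_(t <- ts) hook_weight t).
Proof.
apply: tree_forest_ind => [a|x ts IH||t ts IHt IHts].
- by move=> _; rewrite /= big_nil mul0r.
- move=> xtsS; have /= /and3P[xS /eqP xE tsS] := xtsS.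
  rewrite deg_Node hook_weight_Node mulrA mulfV ?natrS_neq0// mul1r.
  case: ifP => leaf_ts.
    rewrite big_seq1 hook_weight_Leaf big_seq big1// => t tts.
    by have := allP leaf_ts _ tts; case: t {tts} => // a _; exact: hook_weight_Leaf.
  have dts : forall p, p \in forest_prunings prunings ts ->
      forest_deg ts = (forest_deg p.1.1).+1.
    by move=> p /((prunings_sound S).2 ts tsS)[_ _ _ _ []].
  rewrite big_map big_seq.
  under eq_bigr => p /dts pE do rewrite hook_weight_Node -pE.
  rewrite -big_seq -mulr_sumr IH// mulrA mulVf ?mul1r//.
  case: (forest_deg ts) (forest_deg_eq0 ts) => [|d _]; first by rewrite leaf_ts.
  exact: natrS_neq0.
- by move=> _; rewrite /= big_nil mul0r.
move=> /= /andP[tS tsS]; rewrite big_cat /= !big_map /=.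
under eq_bigr do rewrite big_cons.
under [X in _ + X]eq_bigr do rewrite big_cons.
rewrite -mulr_suml -mulr_sumr IHt// IHts// big_cons /forest_deg /= natrD mulrDl.
by rewrite -mulrA; congr (_ + _); rewrite mulrCA.
Qed.

End Weight.

End TreeGrafting.

(** * Evaluation of trees *)

Section Evaluation.
Context (C : finType) (P : colored_operad C).
Implicit Types (S : set P) (t s : tree P) (ts ss : seq (tree P)) (x y z : P).

(** Composition of [ys] at the consecutive positions [k, k + 1, ...] of [x], the
last one first; [comp_from 0] is the complete composition. *)
Definition comp_from (k : nat) x (ys : seq P) : P :=
  foldr (fun p acc => op_comp acc p.1 p.2) x (zip (iota k (size ys)) ys).

Lemma comp_from_cons k x y ys :
  comp_from k x (y :: ys) = op_comp (comp_from k.+1 x ys) k y.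
Proof. by []. Qed.

Lemma onth_cat_size (A : Type) (u v : seq A) a :
  onth (u ++ a :: v) (size u) = Some a.
Proof. by elim: u. Qed.

Lemma comp_from_out_in x ys u v :
  op_in x = u ++ [seq op_out y | y <- ys] ++ v ->
  op_out (comp_from (size u) x ys) = op_out x /\
  op_in (comp_from (size u) x ys) = u ++ flatten [seq op_in y | y <- ys] ++ v.
Proof.
elim: ys u => [|y ys IH] u //= xE.
have [] := IH (rcons u (op_out y)); first by rewrite xE cat_rcons.
rewrite size_rcons comp_from_cons => outE inE'.
have h : onth (op_in (comp_from (size u).+1 x ys)) (size u) = Some (op_out y).
  by rewrite inE' cat_rcons onth_cat_size.
by rewrite op_out_comp// op_in_comp// inE' cat_rcons subst_at_cat -catA.
Qed.

Lemma comp_from_units x u w v : op_in x = u ++ w ++ v ->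
  comp_from (size u) x [seq op_unit P a | a <- w] = x.
Proof.
elim: w u => [|a w IH] u //= xE; rewrite comp_from_cons -(size_rcons u a).
rewrite IH ?cat_rcons// op_unitr// xE.
exact: onth_cat_size.
Qed.

Lemma full_comp_units x : full_comp x [seq op_unit P a | a <- op_in x] = x.
Proof. by apply: (@comp_from_units x [::] _ [::]); rewrite cats0. Qed.

(** Evaluation preserves the output and input colors. *)
Lemma ev_out_in S :
  (forall t, is_syntax_tree S t ->
    op_out (ev t) = tree_out t /\ op_in (ev t) = tree_in t) /\
  (forall ts, all (is_syntax_tree S) ts ->
    [seq op_out (ev t) | t <- ts] = [seq tree_out t | t <- ts] /\
    [seq op_in (ev t) | t <- ts] = [seq tree_in t | t <- ts]).
Proof.
apply: tree_forest_ind => [a _|x ts IH||t ts IHt IHts] //=.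
- by rewrite op_out_unit op_in_unit.
- move=> /and3P[xS /eqP xE /IH[oE iE]].
  have /= := @comp_from_out_in x [seq ev t | t <- ts] [::] [::].
  by rewrite -!map_comp !cats0 /comp oE iE xE; apply.
- by move=> /andP[/IHt[-> ->] /IHts[-> ->]].
Qed.

(** Evaluation turns grafting into partial composition: grafting inside the
tree being composed is the sequential axiom, and grafting to the right of it the
parallel one. *)
Lemma ev_graft S z :
  (forall s i, is_syntax_tree S s -> onth (tree_in s) i = Some (op_out z) ->
    ev (graft z s i) = op_comp (ev s) i z) /\
  (forall ss i, all (is_syntax_tree S) ss ->
    onth (forest_in ss) i = Some (op_out z) ->
    forall x u v, op_in x = u ++ [seq tree_out t | t <- ss] ++ v ->
    comp_from (size u) x [seq ev t | t <- forest_graft (graft z) ss i] =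
    op_comp (comp_from (size u) x [seq ev t | t <- ss]) (size u + i) z).
Proof.
apply: tree_forest_ind => [a|x ts IH||t ts IHt IHts] i.
- case: i => [|i] /=; last by rewrite onth_nil.
  move=> _ [->]; rewrite op_unitl -map_comp.
  exact: full_comp_units.
- move=> /= /and3P[xS /eqP xE tsS] iE.
  by apply: (IH i tsS iE x [::] [::]); rewrite cats0.
- by rewrite /forest_in /= onth_nil.
move=> /= /andP[tS tsS] iE x u v xE.
have [oE nE] := (ev_out_in S).1 t tS.
have [osE nsE] := (ev_out_in S).2 ts tsS.
have [|_] := @comp_from_out_in x [seq ev t | t <- ts] (rcons u (tree_out t)) v.
  by rewrite cat_rcons -map_comp /comp osE.
rewrite -map_comp /comp nsE -/(forest_in ts) size_rcons => cE.
have h : onth (op_in (comp_from (size u).+1 x [seq ev t | t <- ts])) (size u) =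
    Some (op_out (ev t)).
  by rewrite cE oE cat_rcons onth_cat_size.
move: iE; rewrite /forest_in /= onth_cat; case: ltnP => it iE /=.
  by rewrite !comp_from_cons IHt// op_comp_seq// nE.
rewrite !comp_from_cons -(size_rcons u (tree_out t)) (IHts _ tsS iE x _ v) ?cat_rcons//.
rewrite size_rcons -op_comp_par ?ltn_addr//.
  by rewrite nE !addSn /= -addnA subnK.
rewrite cE -(size_rcons u (tree_out t)) onth_cat ltnNge leq_addr /= addKn.
by rewrite onth_cat (onth_size_lt iE).
Qed.

End Evaluation.

(** * Finiteness of the number of factorizations *)

Section Finiteness.

Lemma finite_set_seq (T : Type) (A : set T) n : finite_set A ->
  finite_set [set u : seq T | size u = n /\ List.Forall A u].
Proof.
move=> Afin; elim: n => [|n IH].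
  by apply: (sub_finite_set _ (finite_set1 [::])) => u [/size0nil].
apply: (sub_finite_set _ (finite_image2 cons Afin IH)) => -[|a u] [//= [un]].
move=> au; inversion_clear au.
by exists a => //; exists u.
Qed.

Lemma finite_set_bounded (T : choiceType) (A : set T) (f : T -> nat) :
  finite_set A -> exists M, forall a, A a -> (f a <= M)%N.
Proof.
move=> /finite_seqP[s ->]; exists (\max_(a <- s) f a)%N => a as_.
exact: leq_bigmax_seq.
Qed.

Context (C : finType) (P : colored_operad C).
Implicit Types (S : set P) (t s : tree P) (ts ss : seq (tree P)) (x y z : P).

Lemma finite_Free_deg S n : finite_set S ->
  finite_set [set t | Free S t /\ (deg t <= n)%N].
Proof.
move=> Sfin.
have leaf_fin : finite_set (range (@Leaf C P)) by exact/finite_image/finite_finset.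
elim: n => [|n IH].
  apply: (sub_finite_set _ leaf_fin) => -[a _|x ts [_]]; first by exists a.
  by rewrite deg_Node.
pose A x := [set u : seq (tree P) | size u = arity x /\
  List.Forall [set t | Free S t /\ (deg t <= n)%N] u].
have Nfin : finite_set (\bigcup_(x in S) (Node x @` A x)).
  by apply: bigcup_finite => // x _; apply/finite_image/finite_set_seq.
have LNfin : finite_set (range (@Leaf C P) `|` \bigcup_(x in S) (Node x @` A x)).
  by rewrite finite_setU.
apply: (sub_finite_set _ LNfin) => -[a _|x ts]; first by left; exists a.
rewrite /Free /= deg_Node => -[/and3P[xS /eqP xE tsS] tsn]; right.
exists x; first exact/set_mem.
exists ts => //; split; first by rewrite /arity -xE size_map.
rewrite /forest_deg in tsn; elim: ts tsS tsn {xE} => [|t ts IHts] /=; first by constructor.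
move=> /andP[tS tsS] tsn; constructor; first by split=> //=; lia.
by apply: IHts => //; lia.
Qed.

(** The maximal chain of unary nodes starting at the root of [t], closed by a
leaf. *)
Fixpoint unary_top t : tree P :=
  match t with
  | Node x [:: s] => Node x [:: unary_top s]
  | _ => Leaf (tree_out t)
  end.

Lemma tree_out_unary_top t : tree_out (unary_top t) = tree_out t.
Proof. by case: t => // x [|? []]. Qed.

Lemma unary_top_Free S :
  (forall t, Free S t -> Free (arity_part S 1) (unary_top t)) /\
  (forall ts, all (is_syntax_tree S) ts ->
     all (is_syntax_tree (arity_part S 1)) [seq unary_top t | t <- ts]).
Proof.
apply: tree_forest_ind => [//|x [|t [|t' ts]] //= IH||t ts IHt IHts //= /andP[]] //.
  move=> /and3P[xS /eqP /= xE] /IH /=; rewrite andbT /Free /= => ->.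
  rewrite tree_out_unary_top xE eqxx !andbT.
  by apply/mem_set; split; [exact/set_mem | rewrite /arity -xE].
by rewrite /Free /= in IHt * => /IHt -> /IHts ->.
Qed.

Lemma size_tree_in_unary S :
  (forall t, Free (arity_part S 1) t -> size (tree_in t) = 1%N) /\
  (forall ts, all (is_syntax_tree (arity_part S 1)) ts ->
     size (forest_in ts) = size ts).
Proof.
rewrite /Free /=.
apply: tree_forest_ind => [//|x ts IH|//|t ts IHt IHts] /=.
  move=> /and3P[/set_mem[_ xE] /eqP tsE tsS].
  by rewrite [size _]IH// -xE /arity -tsE size_map.
by rewrite /forest_in /= => /andP[/IHt tS /IHts tsS]; rewrite size_cat tS [size (flatten _)]tsS.
Qed.

Lemma finite_Free_unary S : locally_finite P ->
  finitely_factorizes (arity_part S 1) -> finite_set (Free (arity_part S 1)).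
Proof.
move=> Pfin Sfact.
apply: (sub_finite_set _ (bigcup_finite (Pfin 1%N) (fun x _ => Sfact x))) => t tS.
exists (ev t) => //=; rewrite /arity ((ev_out_in _).1 t tS).2.
exact: (size_tree_in_unary S).1.
Qed.

(** If [M] bounds the length of the chains of unary nodes, the degree of a tree with
[n] leaves is at most that of its top chain plus [2 (n - 1) (M + 1)]. *)
Lemma deg_unary_top_bound S M :
  (forall t, Free (arity_part S 1) t -> (deg t <= M)%N) ->
  let bound t :=
    (deg t <= deg (unary_top t) + (size (tree_in t)).-1.*2 * M.+1)%N in
  (forall t, is_syntax_tree S t -> (0 < size (tree_in t))%N /\ bound t) /\
  (forall ts, all (is_syntax_tree S) ts ->
    [/\ all bound ts, (size ts <= size (forest_in ts))%N &
    (forest_deg ts + size ts * M.+2 <= (size (forest_in ts)).*2 * M.+1)%N]).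
Proof.
move=> SM bound.
apply: tree_forest_ind => [//|x ts IH|//|t ts IHt IHts].
  move=> /= /and3P[_ /eqP xE /IH[bts tsN degN]].
  have ts0 : (0 < size ts)%N by rewrite -(size_map (@tree_out C P)) xE op_arity_gt0.
  rewrite -/(forest_in ts); split; first exact: leq_trans tsN.
  case: ts ts0 bts tsN degN {IH xE} => [|t [|t' ts]] // _.
    move=> /= /andP[+ _] _ _; rewrite /bound /= deg_Node cats0.
    by rewrite deg_Node /forest_deg /= !addn0 addSn.
  (* The root has at least two children, so that its top chain is empty. *)
  move=> _ _; rewrite /bound [tree_in _]/= -/(forest_in _) deg_Node /deg /=.
  set N := size (forest_in _); set d := forest_deg _.
  nia.
move=> /= /andP[tS /IHts[bts tsN degN]]; have [t0 bt] := IHt tS.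
have utM := SM _ ((unary_top_Free S).1 t tS).
rewrite bt bts /forest_in /forest_deg /= size_cat -/(forest_in ts) -/(forest_deg ts).
by split=> //; move: bt; rewrite /bound; nia.
Qed.

Lemma finitely_factorizes_unary S : finite_set S -> locally_finite P ->
  finitely_factorizes (arity_part S 1) -> finitely_factorizes S.
Proof.
move=> Sfin Pfin Sfact x.
have [M SM] := finite_set_bounded (@deg C P) (finite_Free_unary Pfin Sfact).
apply: (sub_finite_set _ (finite_Free_deg (M + (arity x).-1.*2 * M.+1) Sfin)).
move=> t [tS <-]; split=> //=; rewrite /arity ((ev_out_in S).1 t tS).2.
have [_ tb] := (deg_unary_top_bound SM).1 t tS.
apply: (leq_trans tb); rewrite leq_add2r.
exact/SM/(unary_top_Free S).1.
Qed.

End Finiteness.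

Lemma locally_finite_Bud (C : finType) (O : operad) :
  locally_finite O -> locally_finite (Bud C O).
Proof.
move=> Ofin n.
have fin := finite_setX (finite_setX (@finite_finset C setT) (Ofin n))
  (@finite_set_seq C setT n (@finite_finset C setT)).
have inj : {in (val : Bud C O -> C * O * seq C) @^-1` _ &,
            injective (val : Bud C O -> _)} by move=> ? X Y _ _ /val_inj.
apply: (sub_finite_set _ (finite_preimage (inj _) fin)) => X /= XE.
split; first by split=> //=; rewrite -XE [RHS]size_bud_in.
split; first exact: XE.
by elim: (X in List.Forall _ X) => //; constructor.
Qed.

(** * Pre-Lie powers and composition products *)

(** A finite sum can be split along the fibers of a map. *)
Lemma fsbig_fibers (R : nmodType) (I J : choiceType) (A : set I) (D : set J)
    (g : I -> J) (F : I -> R) :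
  finite_set A -> (forall i, A i -> D (g i)) ->
  \sum_(i \in A) F i = \sum_(j \in D) \sum_(i \in A `&` g @^-1` [set j]) F i.
Proof.
move=> Afin AD.
rewrite -(@fsbig_widen _ _ _ _ (g @` A)); first last.
- move=> j /= [_ jA]; apply: fsbig1 => i [Ai ij].
  by case: jA; exists i.
- by move=> _ [i Ai <-]; exact: AD.
under [RHS]eq_fsbigr do rewrite fsbig_mkcondr.
rewrite exchange_fsbig//; last exact: finite_image.
apply: eq_fsbigr => i /set_mem Ai.
rewrite -(@fsbig_widen _ _ _ _ [set g i]); first last.
- by move=> j /= [_ ji]; rewrite memNset// => ij; apply: ji.
- by move=> _ ->; exists i.
by rewrite fsbig_set1 mem_set.
Qed.

Section Powers.
Context (K : fieldType) (charK0 : [pchar K] =i pred0).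
Context (C : finType) (P : colored_operad C).
Implicit Types (S : set P) (t s : tree P) (ts ss : seq (tree P)) (x y z : P).
Local Notation weight := (@hook_weight C P K).

Lemma char_seriesE S x : char_series K S x = (x \in S)%:R.
Proof. by []. Qed.

Lemma op_unit_inj : injective (op_unit P).
Proof. by move=> a b /(congr1 (@op_out C P)); rewrite !op_out_unit. Qed.

Lemma deg_eq0 t : deg t = 0%N -> exists a, t = Leaf a.
Proof. by case: t => [a|x ts]; [exists a | rewrite deg_Node]. Qed.

(** The coefficients of the pre-Lie powers of a finite set of rules. *)
Lemma prelie_pow_hook S : finite_set S -> forall l x,
  prelie_pow (char_series K S) l x =
  \sum_(t \in [set t | [/\ Free S t, deg t = l & ev t = x]])
    (l`!%:R * weight t).
Proof.
move=> Sfin; have fin l x :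
    finite_set [set t | [/\ Free S t, deg t = l & ev t = x]].
  by apply: (sub_finite_set _ (finite_Free_deg l Sfin)) => t [? <- _].
elim=> [|l IH] x.
  rewrite /prelie_pow /= /unit_series char_seriesE.
  case: (pselect (exists a, x = op_unit P a)) => [[a ->]|nx].
    rewrite mem_set; last by exists a; rewrite ?in_setT.
    rewrite (_ : [set t | _] = [set Leaf a]).
      by rewrite fsbig_set1 hook_weight_Leaf mulr1.
    apply/seteqP; split=> [t [_ /deg_eq0[b ->] /op_unit_inj->]//|_ ->].
    by split.
  rewrite memNset; last by move=> [a _ xa]; apply: nx; exists a.
  rewrite fsbig1// => t [_ /deg_eq0[b ->] xb].
  by case: nx; exists b.
rewrite /prelie_pow iterS -/(prelie_pow _ _) /prelie.
(* Both sides are compared with a sum over the set [Q] of all the graftings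
   [(s, i, z)] that give a tree of degree [l.+1] evaluating to [x]. *)
pose B := [set t | [/\ Free S t, deg t = l.+1 & ev t = x]].
pose Q := \bigcup_(t in B) [set` prunings t].
have Qfin : finite_set Q.
  by apply: bigcup_finite => [|t _]; [exact: fin | exact: finite_seq].
have QP p : Q p <-> [/\ Free S p.1.1, deg p.1.1 = l, p.2 \in S,
    onth (tree_in p.1.1) p.1.2 = Some (op_out p.2) &
    op_comp (ev p.1.1) p.1.2 p.2 = x].
  split.
    move=> [t [tS td tx] /= pt].
    have [pS p2 pE pg [_ pd]] := (prunings_sound S).1 t tS p pt.
    split=> //; first by move: pd; rewrite td => -[].
    by rewrite -((ev_graft S p.2).1 _ _ pS pE) pg.
  move=> [pS pd p2 pE px]; exists (graft p.2 p.1.1 p.1.2).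
    split; first exact: (graft_Free p2).1.
      by rewrite (deg_graft p.2).1// pd.
    by rewrite ((ev_graft S p.2).1 _ _ pS pE).
  rewrite /=; have [_] := (prunings_complete p.2).1 _ _ pE.
  by case: (p) => -[].
transitivity (\sum_(p \in Q) (l`!%:R * weight p.1.1)).
  (* On the pre-Lie side, group the graftings by [(ev s, i, z)]. *)
  rewrite (@fsbig_fibers _ _ _ Q [set p : P * nat * P |
      composable p.1.1 p.1.2 p.2 /\ x = op_comp p.1.1 p.1.2 p.2]
      (fun p => (ev p.1.1, p.1.2, p.2)))//; last first.
    move=> p /QP[pS _ _ pE px] /=; split=> //.
    by rewrite /composable ((ev_out_in S).1 _ pS).2.
  apply: eq_fsbigr => -[[y i] z] /set_mem/= [yiz xE].
  rewrite char_seriesE; case: (boolP (z \in S)) => zS; last first.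
    rewrite mulr0 fsbig1// => p [/QP[_ _ p2 _ _] /= [_ _ pz]].
    by rewrite -pz p2 in zS.
  rewrite mulr1 IH.
  rewrite (_ : Q `&` _ = (fun t => (t, i, z)) @`
     [set t | [/\ Free S t, deg t = l & ev t = y]]).
    by rewrite fsbig_image// => ? ? _ _ [].
  apply/seteqP; split=> [[[t j] w] [/QP/= [tS td wS _ _] [ty <- <-]]|_ [t [tS td ty] <-]].
    by exists t.
  split=> /=; last by rewrite ty.
  apply/QP; split=> //=; last by rewrite ty.
  by rewrite -((ev_out_in S).1 _ tS).2 ty.
(* On the tree side, group them by the grafted tree. *)
rewrite (@fsbig_fibers _ _ _ Q B (fun p => graft p.2 p.1.1 p.1.2))//; last first.
  move=> p [t [tS td tx] /= pt].
  by have [_ _ _ -> _] := (prunings_sound S).1 t tS p pt.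
apply: eq_fsbigr => t /set_mem [tS td tx].
have -> : Q `&` (fun p => graft p.2 p.1.1 p.1.2) @^-1` [set t] = [set` prunings t].
  apply/seteqP; split=> [p [/QP[_ _ _ pE _] /= <-]|p /= pt].
    have [_] := (prunings_complete p.2).1 _ _ pE.
    by case: (p) => -[].
  split; first by exists t.
  by have [] := (prunings_sound S).1 t tS p pt.
rewrite -fsbig_seq; last exact: (prunings_uniq S).1.
by rewrite -mulr_sumr (sum_prunings charK0 S).1// td mulrA -natrM mulnC.
Qed.

Lemma prelie_star_hook S : finite_set S -> finitely_factorizes S -> forall x,
  prelie_star (char_series K S) x =
  \sum_(t \in [set t | Free S t /\ ev t = x]) ((deg t)`!%:R * weight t).
Proof.
move=> Sfin Sfact x; rewrite /prelie_star.
rewrite (@fsbig_fibers _ _ _ _ [set: nat] (@deg C P))//.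
apply: eq_fsbigr => l _; rewrite prelie_pow_hook//.
rewrite (_ : [set t | [/\ _, _ & _]] =
   [set t | Free S t /\ ev t = x] `&` (@deg C P) @^-1` [set l]).
  by apply: eq_fsbigr => t /set_mem[_ /= ->].
by apply/seteqP; split=> t => [[]|[[]]].
Qed.

Lemma char_units_unit (A : {set C}) a :
  char_series K (units_of P A) (op_unit P a) = (a \in A)%:R.
Proof.
rewrite char_seriesE; congr (_%:R); congr nat_of_bool.
apply/idP/idP => [/set_mem[b bA /op_unit_inj->//]|aA].
by apply/mem_set; exists a.
Qed.

Lemma composition_prod_unitsl (A : {set C}) (f : series K P) x :
  composition_prod (char_series K (units_of P A)) f x =
  (op_out x \in A)%:R * f x.
Proof.
pose p0 : P * seq P := (op_unit P (op_out x), [:: x]).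
rewrite /composition_prod -(@fsbig_widen _ _ _ _ [set p0]); first last.
- move=> [y ys] /= [[yE xE] np0]; rewrite char_seriesE.
  case: (boolP (y \in _)) => [/set_mem[a aA ya]|_]; last by rewrite mul0r.
  case: np0; move: yE xE; rewrite ya /full_composable op_in_unit.
  case: ys => [|z []]//= [<-]; rewrite /full_comp /= op_unitl => xz.
  by rewrite /p0 xz.
- move=> _ ->; split; rewrite /full_composable /= ?op_in_unit//.
  by rewrite /full_comp /= op_unitl.
by rewrite fsbig_set1 big_seq1 char_units_unit.
Qed.

Lemma composition_prod_unitsr (A : {set C}) (f : series K P) x :
  composition_prod f (char_series K (units_of P A)) x =
  (all [in A] (op_in x))%:R * f x.
Proof.
pose p0 : P * seq P := (x, [seq op_unit P a | a <- op_in x]).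
rewrite /composition_prod -(@fsbig_widen _ _ _ _ [set p0]); first last.
- move=> [y ys] /= [[yE xE] np0].
  case: (boolP (all (fun z => z \in units_of P A) ys)) => [/allP ysA|]; last first.
    move=> /allPn[z zys zA]; rewrite [\prod_(_ <- _) _](_ : _ = 0) ?mulr0//.
    apply/eqP; rewrite prodf_seq_eq0; apply/hasP; exists z => //=.
    by rewrite char_seriesE (negbTE zA).
  case: np0; have ysE : ys = [seq op_unit P a | a <- op_in y].
    rewrite -yE -map_comp -[LHS]map_id; apply/eq_in_map => z /ysA /set_mem[a _ ->] /=.
    by rewrite op_out_unit.
  by move: xE; rewrite ysE full_comp_units /p0 => ->.
- move=> _ ->; split; rewrite /full_composable /= ?full_comp_units// -map_comp.
  by rewrite -[RHS]map_id; apply: eq_map => a; rewrite /= op_out_unit.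
rewrite fsbig_set1 mulrC big_map; congr (_ * _).
elim: (op_in x) => [|a u IHu]; first by rewrite big_nil.
by rewrite big_cons IHu char_units_unit /= -natrM mulnb.
Qed.

End Powers.

(** * The hook generating series *)

Theorem theorem3p3p5 (K : fieldType) (charK0 : [pchar K] =i pred0)
    (B : bud_generating_system)
    (locfin : locally_finite (bgs_operad B))
    (finfact : finitely_factorizes
       (arity_part (bgs_rules B : set (bgs_bud B)) 1)) :
  hook K B =
  series_sum
    [set t : tree (bgs_bud B) |
       [/\ Free (bgs_rules B) t,
           tree_out t \in bgs_initial B
         & plus_words (bgs_terminal B) (tree_in t)]]
    (fun t => (deg t)`!%:R / \prod_(s <- node_subtrees t) (deg s)%:R)
    (fun t => ev t).
Proof.
apply/funext => x.
have Rfact : finitely_factorizes (bgs_rules B : set (bgs_bud B)).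
  apply: finitely_factorizes_unary finfact; first exact: bgs_rules_finite.
  exact: locally_finite_Bud.
rewrite /hook composition_prod_unitsr composition_prod_unitsl.
rewrite (prelie_star_hook charK0)//; last exact: bgs_rules_finite.
rewrite mulrA -natrM mulnb mulr_fsumr /series_sum.
rewrite [LHS]fsbig_mkcond [RHS]fsbig_mkcond; apply: eq_fsbigr => t _.
rewrite /patch -/(hook_weight K t) /char_series.
case: (pselect (Free (bgs_rules B) t)) => [tR|ntR]; last first.
  by rewrite !memNset//= => -[].
have [oE iE] := (ev_out_in (bgs_rules B : set (bgs_bud B))).1 t tR.
have [tx|ntx] := eqVneq (ev t) x; last first.
  rewrite memNset => [|[_ tx]]; last by rewrite tx eqxx in ntx.
  rewrite (memNset (A := [set ev t])) ?mulr0 ?if_same// => /= xt.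
  by rewrite xt eqxx in ntx.
rewrite -tx (mem_set (A := [set ev t]))// mulr1 oE iE.
rewrite mem_set//; case: ifPn => [/set_mem[_ outI [_ inT]]|nA].
  by rewrite outI (_ : all _ _ = true) ?mul1r//; apply/allP.
case: (boolP (all _ _)) => [/allP inT|]; last by rewrite mul0r.
case: (boolP (tree_out t \in _)) => [outI|]; last by rewrite mul0r.
case/negP: nA; apply/mem_set; split=> //; split=> // t0.
by have := op_arity_gt0 (ev t); rewrite iE t0.
Qed.
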